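(* Let $\ell\in\mathbb{N}$, let $\mathcal{A}\subset\mathscr{P}(\mathbb{N}_0)$ be a Furstenberg family, and let $f:X\to X$ be a continuous map on a metric space $(X,d)$. The following are equivalent: (i) $(X^N,f_{(N)})$ is topologically $(\ell,\mathcal{A})$-recurrent for every $N\in\mathbb{N}$; (ii) $(\mathcal{K}(X),\overline f)$ is topologically $(\ell,\mathcal{A})$-recurrent; (iii) $(\mathcal{F}_\infty(X),\hat f)$ is topologically $(\ell,\mathcal{A})$-recurrent; (iv) $(\mathcal{F}_0(X),\hat f)$ is topologically $(\ell,\mathcal{A})$-recurrent; (v) $(\mathcal{F}_S(X),\hat f)$ is topologically $(\ell,\mathcal{A})$-recurrent; (vi) $(\mathcal{F}_E(X),\hat f)$ is topologically $(\ell,\mathcal{A})$-recurrent. Consequently these equivalences also hold with ''topologically $(\ell,\mathcal{A})$-recurrent'' replaced by any of ''topologically recurrent'', ''multiply recurrent'', or ''topologically $\mathcal{A}$-recurrent''.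
   Context: $\mathbb{N}=\{1,2,\dots\}$, $\mathbb{N}_0=\mathbb{N}\cup\{0\}$, $\mathbb{I}=[0,1]$. A Furstenberg family is $\mathcal{A}\subset\mathscr{P}(\mathbb{N}_0)$ with $\varnothing\notin\mathcal{A}$ and upward hereditary. For a continuous map $g$ on a topological space $Y$ and $U\subset Y$, $\mathcal{N}^\ell_g(U)=\{n\in\mathbb{N}_0:\bigcap_{0\le j\le\ell}g^{-jn}(U)\ne\varnothing\}$. $(Y,g)$ is topologically $(\ell,\mathcal{A})$-recurrent if $\mathcal{N}^\ell_g(U)\in\mathcal{A}$ for every non-empty open $U$; topologically recurrent if for every non-empty open $U$ there is $n\in\mathbb{N}$ with $g^n(U)\cap U\ne\varnothing$; multiply recurrent if for every $\ell\in\mathbb{N}$ and non-empty open $U$ there is $n\in\mathbb{N}$ with $\bigcap_{0\le j\le\ell}g^{-jn}(U)\ne\varnothing$; topologically $\mathcal{A}$-recurrent if $\{n\in\mathbb{N}_0: g^n(U)\cap U\ne\varnothing\}\in\mathcal{A}$ for every non-empty open $U$. $f_{(N)}=f\times\cdots\times f$ on $X^N$ with product topology. Fuzzy setting: for $u:X\to\mathbb{I}$, $u_\alpha=\{x:u(x)\ge\alpha\}$ ($\alpha\in]0,1]$), $u_0=\overline{\{x:u(x)>0\}}$. $\mathcal{F}(X)$: upper-semicontinuous $u:X\to\mathbb{I}$ with $u_0$ compact and $u_1\ne\varnothing$. $\mathcal{K}(X)$: non-empty compact subsets with Hausdorff metric $d_H$; $\overline f(K)=f(K)$. Zadeh extension: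 $\hat f(u)(x)=\sup\{u(y):f(y)=x\}$ (and $0$ if $f^{-1}(\{x\})=\varnothing$). Metrics on $\mathcal{F}(X)$: $d_\infty(u,v)=\sup_{\alpha\in\mathbb{I}}d_H(u_\alpha,v_\alpha)$; $d_0(u,v)=\inf\{\varepsilon>0:\exists\xi\in\mathcal{T},\ \sup_\alpha|\xi(\alpha)-\alpha|\le\varepsilon,\ d_\infty(u,\xi\circ v)\le\varepsilon\}$ with $\mathcal{T}$ the strictly increasing homeomorphisms of $\mathbb{I}$; with $\overline d((x,\alpha),(y,\beta))=\max\{d(x,y),|\alpha-\beta|\}$, $\operatorname{end}(u)=\{(x,\alpha):u(x)\ge\alpha\}$, $\operatorname{send}(u)=\operatorname{end}(u)\cap(u_0\times\mathbb{I})$, $d_E$ and $d_S$ are the $\overline d$-Hausdorff distances of endographs and sendographs respectively. $\mathcal{F}_\rho(X)$ denotes $(\mathcal{F}(X),\rho)$. *)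

(* Defs.v *)
From HB Require Import structures.
From mathcomp Require Import all_boot all_order all_algebra.
From mathcomp Require Import all_classical all_reals all_analysis.
Set Implicit Arguments. Unset Strict Implicit. Unset Printing Implicit Defensive.
Import Order.TTheory GRing.Theory Num.Theory.
Local Open Scope classical_set_scope.
Local Open Scope ring_scope.

Section Defs.
Variable R : realType.

Definition is_metric (X : Type) (d : X -> X -> R) : Prop :=
  [/\ (forall x y, 0 <= d x y),
      (forall x y, d x y = 0 <-> x = y),
      (forall x y, d x y = d y x) &
      (forall x y z, d x z <= d x y + d y z)].

Definition dcontinuous (X : Type) (d : X -> X -> R) (f : X -> X) : Prop :=
  forall x (e : R), 0 < e -> exists2 del : R, 0 < del &
    forall y, d x y < del -> d (f x) (f y) < e.

Definition dopen (X : Type) (d : X -> X -> R) (U : set X) : Prop :=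
  forall x, U x -> exists2 r : R, 0 < r & forall y, d x y < r -> U y.

Definition dcompact (X : Type) (d : X -> X -> R) (K : set X) : Prop :=
  forall (I : Type) (G : I -> set X), (forall i, dopen d (G i)) ->
    K `<=` \bigcup_i G i ->
    exists (n : nat) (h : 'I_n -> I), K `<=` \bigcup_(k in setT) G (h k).

Definition dclosure (X : Type) (d : X -> X -> R) (S : set X) : set X :=
  [set x | forall e : R, 0 < e -> exists2 y, S y & d x y < e].

Definition hausdorff (T : Type) (D : T -> T -> R) (A B : set T) : \bar R :=
  maxe (ereal_sup [set ereal_inf [set (D a b)%:E | b in B] | a in A])
       (ereal_sup [set ereal_inf [set (D b a)%:E | a in A] | b in B]).

Definition Kspace (X : Type) (d : X -> X -> R) : set (set X) :=
  [set K | K !=set0 /\ dcompact d K].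
Definition Kball (X : Type) (d : X -> X -> R) (K : set X) (r : R) : set (set X) :=
  [set L | (hausdorff d K L < r%:E)%E].
Definition Kmap (X : Type) (f : X -> X) (K : set X) : set X := f @` K.

Definition unit_itv : set R := [set a | 0 <= a <= 1].

Definition usc (X : Type) (d : X -> X -> R) (u : X -> R) : Prop :=
  forall x (e : R), 0 < e -> exists2 del : R, 0 < del &
    forall y, d x y < del -> u y < u x + e.

Definition level (X : Type) (d : X -> X -> R) (u : X -> R) (a : R) : set X :=
  if a == 0 then dclosure d [set x | 0 < u x] else [set x | a <= u x].

Definition Fspace (X : Type) (d : X -> X -> R) : set (X -> R) :=
  [set u | [/\ (forall x, unit_itv (u x)), usc d u,
               dcompact d (level d u 0) & level d u 1 !=set0]].

Definition zadeh (X : Type) (f : X -> X) (u : X -> R) : X -> R :=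
  fun x => if pselect (exists y, f y = x)
           then sup [set u y | y in f @^-1` [set x]] else 0.

Definition d_infty (X : Type) (d : X -> X -> R) (u v : X -> R) : \bar R :=
  ereal_sup [set hausdorff d (level d u a) (level d v a) | a in unit_itv].

Definition homeoI (xi : R -> R) : Prop :=
  [/\ (forall a, unit_itv a -> unit_itv (xi a)),
      (forall b, unit_itv b -> exists2 a, unit_itv a & xi a = b),
      (forall a b, unit_itv a -> unit_itv b -> a < b -> xi a < xi b) &
      (forall a (e : R), unit_itv a -> 0 < e -> exists2 del : R, 0 < del &
         forall b, unit_itv b -> `|a - b| < del -> `|xi a - xi b| < e)].

Definition d_skor (X : Type) (d : X -> X -> R) (u v : X -> R) : \bar R :=
  ereal_inf [set e%:E | e in [set e : R | 0 < e /\
     exists xi, [/\ homeoI xi, (forall a, unit_itv a -> `|xi a - a| <= e) &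
                    (d_infty d u (xi \o v) <= e%:E)%E]]].

Definition dbar (X : Type) (d : X -> X -> R) (p q : X * R) : R :=
  Num.max (d p.1 q.1) `|p.2 - q.2|.

Definition endo (X : Type) (u : X -> R) : set (X * R) :=
  [set p | unit_itv p.2 /\ p.2 <= u p.1].
Definition sendo (X : Type) (d : X -> X -> R) (u : X -> R) : set (X * R) :=
  [set p | endo u p /\ level d u 0 p.1].

Definition d_E (X : Type) (d : X -> X -> R) (u v : X -> R) : \bar R :=
  hausdorff (dbar d) (endo u) (endo v).
Definition d_S (X : Type) (d : X -> X -> R) (u v : X -> R) : \bar R :=
  hausdorff (dbar d) (sendo d u) (sendo d v).

Definition rho_ball (Y : Type) (rho : Y -> Y -> \bar R) (y : Y) (r : R) : set Y :=
  [set z | (rho y z < r%:E)%E].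

(* basic product neighbourhoods (finitely many coordinates => common radius) *)
Definition prod_ball (X : Type) (d : X -> X -> R) (N : nat)
  (x : 'I_N -> X) (r : R) : set ('I_N -> X) :=
  [set y | forall i, d (x i) (y i) < r].
Definition fprod (X : Type) (f : X -> X) (N : nat) (x : 'I_N -> X) : 'I_N -> X :=
  fun i => f (x i).

Definition sp_open (Y : Type) (P : set Y) (ball : Y -> R -> set Y) (U : set Y) :=
  U `<=` P /\ forall y, U y -> exists2 r : R, 0 < r &
    forall z, P z -> ball y r z -> U z.

Definition Nl (Y : Type) (g : Y -> Y) (l : nat) (U : set Y) : set nat :=
  [set n | exists y, U y /\ forall j, (j <= l)%N -> U (iter (j * n) g y)].

Definition space_prop := forall Y : Type, set Y -> (Y -> R -> set Y) -> (Y -> Y) -> Prop.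

Definition lA_recurrent (l : nat) (A : set (set nat)) : space_prop :=
  fun Y P ball g => forall U, sp_open P ball U -> U !=set0 -> A (Nl g l U).

Definition top_recurrent : space_prop :=
  fun Y P ball g => forall U, sp_open P ball U -> U !=set0 ->
    exists n, (0 < n)%N /\ exists y, U y /\ U (iter n g y).

Definition mult_recurrent : space_prop :=
  fun Y P ball g => forall l, (0 < l)%N -> forall U, sp_open P ball U -> U !=set0 ->
    exists n, (0 < n)%N /\ Nl g l U n.

Definition A_recurrent (A : set (set nat)) : space_prop :=
  fun Y P ball g => forall U, sp_open P ball U -> U !=set0 ->
    A [set n | exists y, U y /\ U (iter n g y)].

Definition furstenberg (A : set (set nat)) : Prop :=
  ~ A set0 /\ forall S T, A S -> S `<=` T -> A T.

Definition six_equiv (X : Type) (d : X -> X -> R) (f : X -> X) (Q : space_prop) : Prop :=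
  [<-> forall N, (0 < N)%N -> Q _ setT (prod_ball d (N:=N)) (fprod f (N:=N));
       Q _ (Kspace d) (Kball d) (Kmap f);
       Q _ (Fspace d) (rho_ball (d_infty d)) (zadeh f);
       Q _ (Fspace d) (rho_ball (d_skor d)) (zadeh f);
       Q _ (Fspace d) (rho_ball (d_S d)) (zadeh f);
       Q _ (Fspace d) (rho_ball (d_E d)) (zadeh f)].

End Defs.

(* Main.v *)
Require Import Defs.
From HB Require Import structures.
From mathcomp Require Import all_boot all_order all_algebra.
From mathcomp Require Import all_classical all_reals all_analysis.
From mathcomp Require Import lra.
Local Open Scope classical_set_scope.
Local Open Scope ring_scope.
Import Order.TTheory GRing.Theory Num.Theory.

(* Finite sets are dense in the hyperspace, and finitely supported fuzzy sets
   with fixed weights are dense for d_infty; both are images of X^N under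
   equivariant Lipschitz maps, so recurrence of all X^N passes to them, and then
   along d_E <= d_S <= d_0 <= d_infty.  Conversely, a compact set (or a
   1/2-level set) K near {x_1, ..., x_N} whose iterates stay near it controls
   the points only up to a permutation of the balls U_i around the x_i.  This is
   harmless: if some iterate of U_i meets U_k, then U_k can be dropped after
   shrinking U_i; and once no arrow U_i -> U_k is left, a point of K in U_i whose
   orbit stays in the union of the balls returns to U_i itself. *)

(** * Hausdorff distance and open balls *)

Section Hausdorff.
Set Implicit Arguments.
Unset Strict Implicit.
Context {R : realType} {T : Type} (D : T -> T -> R).

(** The minimum of the chosen radii works for all indices; seeding it with 1 keeps it positive when
    [N = 0]. *)
Lemma fin_radius N (P : 'I_N -> R -> Prop) :
  (forall i r s, 0 < s -> s <= r -> P i r -> P i s) ->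
  (forall i, exists2 r, 0 < r & P i r) ->
  exists2 r, 0 < r & forall i, P i r.
Proof.
move=> Pmono /(_ _)/cid2-/all_sig2[r r0 Pr].
exists (\big[Num.min/1]_(i < N) r i); first exact: lt_bigmin.
by move=> i; apply: Pmono (Pr i); [exact: lt_bigmin|exact: bigmin_le_cond].
Qed.

(** A strict bound yields strict witnesses, but witnesses give back only a weak bound, because of
    the supremum. Hence the implications from [<] to [<=] in the comparisons below. *)
Lemma hausdorff_lt A B r : (hausdorff D A B < r%:E)%E ->
  (forall a, A a -> exists2 b, B b & D a b < r) /\
  (forall b, B b -> exists2 a, A a & D b a < r).
Proof.
rewrite /hausdorff gt_max => /andP[hA hB]; split => [a Aa|b Bb].
- have : (ereal_inf [set (D a b)%:E | b in B] < r%:E)%E.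
    by apply: le_lt_trans hA; apply: ereal_sup_ubound; exists a.
  by move=> /ereal_inf_lt[_ [b Bb <-]]; rewrite lte_fin; exists b.
- have : (ereal_inf [set (D b a)%:E | a in A] < r%:E)%E.
    by apply: le_lt_trans hB; apply: ereal_sup_ubound; exists b.
  by move=> /ereal_inf_lt[_ [a Aa <-]]; rewrite lte_fin; exists a.
Qed.

Lemma hausdorff_le A B r :
  (forall a, A a -> exists2 b, B b & D a b <= r) ->
  (forall b, B b -> exists2 a, A a & D b a <= r) ->
  (hausdorff D A B <= r%:E)%E.
Proof.
move=> hA hB; rewrite /hausdorff ge_max; apply/andP; split;
  apply: ge_ereal_sup => _ [t At <-].
- have [b Bb tb] := hA _ At; apply: (@le_trans _ _ (D t b)%:E).
    by apply: ereal_inf_lbound; exists b.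
  by rewrite lee_fin.
- have [a Aa ta] := hB _ At; apply: (@le_trans _ _ (D t a)%:E).
    by apply: ereal_inf_lbound; exists a.
  by rewrite lee_fin.
Qed.

Lemma hausdorff_triangle A B C r s :
  (forall x y z, D x z <= D x y + D y z) ->
  (hausdorff D A B < r%:E)%E -> (hausdorff D B C < s%:E)%E ->
  (hausdorff D A C <= (r + s)%:E)%E.
Proof.
move=> tri /hausdorff_lt[AB BA] /hausdorff_lt[BC CB]; apply: hausdorff_le.
- move=> a /AB[b /BC[c Cc bc] ab]; exists c => //.
  by have := tri a b c; lra.
- move=> c /CB[b /BA[a Aa ba] cb]; exists a => //.
  by have := tri c b a; lra.
Qed.

Lemma sp_open_rho_ball (P : set T) (rho : T -> T -> \bar R) y0 r :
  (forall y z s t, (rho y0 y < s%:E)%E -> (rho y z < t%:E)%E ->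
     (rho y0 z <= (s + t)%:E)%E) ->
  sp_open P (rho_ball rho) [set y | P y /\ (rho y0 y < r%:E)%E].
Proof.
move=> tri; split=> [y []//|y [Py yr]].
(* The triangle inequality is available only for real bounds, so a real [s] is inserted between the
   distance and [r]; [r - 1] serves when the distance is -oo. *)
have [s ys sr] : exists2 s, (rho y0 y < s%:E)%E & s < r.
  case: (rho y0 y) yr => [e| |]; rewrite ?lte_fin => // er.
    by exists ((e + r) / 2); rewrite ?lte_fin; lra.
  by exists (r - 1); rewrite ?ltNyr//; lra.
exists ((r - s) / 2); first lra.
move=> z Pz /(tri _ _ _ _ ys) yz; split => //.
by apply: le_lt_trans yz _; rewrite lte_fin; lra.
Qed.

End Hausdorff.

(** * Transfer of recurrence between systems *)

Section Transfer.
Set Implicit Arguments.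
Unset Strict Implicit.
Context {R : realType}.

Definition up_closed (A : set (set nat)) := forall S S', A S -> S `<=` S' -> A S'.

(** Serves three times: with [phi] a map from a power of [X], with the identity to undo a shrinking,
    and with an iterate of [f] to push returns along an arrow. *)
Lemma Nl_sub {Y1 Y2 : Type} (g1 : Y1 -> Y1) (g2 : Y2 -> Y2) (phi : Y1 -> Y2) l U V :
  (forall m y, phi (iter m g1 y) = iter m g2 (phi y)) ->
  (forall y, U y -> V (phi y)) -> Nl g1 l U `<=` Nl g2 l V.
Proof.
move=> eqv UV n [y [Uy hy]]; exists (phi y); split; first exact: UV.
by move=> j jl; rewrite -eqv; apply/UV/hy.
Qed.

Lemma sp_open_coarser (Y : Type) (P : set Y) (rho1 rho2 : Y -> Y -> \bar R) U :
  (forall u v r, P u -> P v -> (rho2 u v < r%:E)%E -> (rho1 u v <= r%:E)%E) ->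
  sp_open P (rho_ball rho1) U -> sp_open P (rho_ball rho2) U.
Proof.
move=> le12 [UP Uo]; split=> // y Uy; have [r r0 hr] := Uo _ Uy.
(* Halving the radius absorbs the passage from a strict to a weak bound. *)
exists (r / 2) => [|z Pz yz]; first lra.
apply: hr => //; apply: le_lt_trans (le12 _ _ _ (UP _ Uy) Pz yz) _.
by rewrite lte_fin; lra.
Qed.

Lemma lA_recurrent_coarser (Y : Type) (P : set Y) (rho1 rho2 : Y -> Y -> \bar R)
    (g : Y -> Y) l A :
  (forall u v r, P u -> P v -> (rho2 u v < r%:E)%E -> (rho1 u v <= r%:E)%E) ->
  lA_recurrent l A P (rho_ball rho2) g -> lA_recurrent l A P (rho_ball rho1) g.
Proof. by move=> le12 H U Uo; apply: H; apply: sp_open_coarser Uo. Qed.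

(** The preimage of an open set under the equivariant Lipschitz map [phi] is open, and density makes
    it non-empty. As [N] varies with the approximated point, recurrence of every power is
    assumed. *)
Lemma lA_recurrent_dense (X Y : Type) (d : X -> X -> R) (f : X -> X) (P : set Y)
    (rho : Y -> Y -> \bar R) (g : Y -> Y) l A :
  up_closed A ->
  (forall u r, P u -> 0 < r -> exists N, (0 < N)%N /\
     exists phi : ('I_N -> X) -> Y,
     [/\ forall y, P (phi y),
         forall y, phi (Defs.fprod f y) = g (phi y),
         forall y z s, 0 < s -> (forall i, d (y i) (z i) < s) ->
           (rho (phi y) (phi z) <= s%:E)%E &
         exists y, (rho u (phi y) < r%:E)%E]) ->
  (forall N, (0 < N)%N -> lA_recurrent l A setT (Defs.prod_ball d (N:=N)) (Defs.fprod f (N:=N))) ->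
  lA_recurrent l A P (rho_ball rho) g.
Proof.
move=> Aup dense rec U [UP Uo] [u Uu].
have [r r0 hr] := Uo _ Uu.
have [N [N0 [phi [Pphi eqv lip [y uy]]]]] := dense _ _ (UP _ Uu) r0.
have eqvm m z : phi (iter m (@Defs.fprod _ f N) z) = iter m g (phi z).
  by elim: m => //= m <-; rewrite eqv.
apply: Aup (rec _ N0 (phi @^-1` U) _ _) (Nl_sub eqvm _) => //.
- split=> // z Uz; have [s s0 hs] := Uo _ Uz.
  exists (s / 2) => [|w _ zw]; first lra.
  apply: hs => //; apply: le_lt_trans (lip _ _ (s / 2) _ zw) _; first lra.
  by rewrite lte_fin; lra.
- by exists y; apply: hr.
Qed.

End Transfer.

(** * Finite sets, compactness and semicontinuity *)

Section Metric.
Set Implicit Arguments.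
Unset Strict Implicit.
Context {R : realType} {X : Type} (d : X -> X -> R).
Hypothesis dm : is_metric d.

Let d_ge0 x y : 0 <= d x y. Proof. by case: dm. Qed.
Let dxx x : d x x = 0. Proof. by case: dm => _ h _ _; apply/h. Qed.
Let d_eq x y : d x y = 0 -> x = y. Proof. by case: dm => _ h _ _; move/h. Qed.
Let dC x y : d x y = d y x. Proof. by case: dm. Qed.
Let dD x y z : d x z <= d x y + d y z. Proof. by case: dm. Qed.

Lemma dopen_ball x r : dopen d [set y | d x y < r].
Proof.
move=> y /= xy; exists (r - d x y) => [|z yz]; first lra.
by have := dD x y z; rewrite /=; lra.
Qed.

(** Used to show that a finite support is closed and that a finitely supported fuzzy set is upper
    semicontinuous. *)
Lemma fin_separation N (y : 'I_N -> X) x :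
  exists2 r, 0 < r & forall i, d x (y i) < r -> y i = x.
Proof.
apply: (@fin_radius R N (fun i r => d x (y i) < r -> y i = x)) => [i r s _ sr h xs|i].
  by apply: h; apply: lt_le_trans sr.
have [/d_eq ->|xy] := eqVneq (d x (y i)) 0; first by exists 1.
by exists (d x (y i)); rewrite ?ltxx// lt_neqAle eq_sym xy d_ge0.
Qed.

Lemma dcompact_fin N (y : 'I_N -> X) : dcompact d (range y).
Proof.
move=> I G _ cov.
have /choice[h hh] i : exists j, G j (y i).
  by have [j _ ?] := cov (y i) (imageT y i); exists j.
by exists N, h => _ [i _ <-]; exists i.
Qed.

Lemma dcompact_net K r : dcompact d K -> 0 < r ->
  exists N (x : 'I_N -> X), (forall i, K (x i)) /\
    forall z, K z -> exists i, d (x i) z < r.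
Proof.
(* Indexing the cover by the points of [K] puts the centres of the subcover in [K]. *)
move=> Kc r0; have [|z Kz|N [h hh]] := Kc {x | K x} (fun x => [set y | d (sval x) y < r]).
- by move=> x; apply: dopen_ball.
- by exists (exist _ z Kz) => //=; rewrite dxx.
exists N, (fun i => sval (h i)); split=> [i|z /hh[i _ ?]]; first exact: svalP.
by exists i.
Qed.

(* Without a maximum, the sets [u < u z] with z in K would cover K; a finite
   subcover fails at its own z with the largest value of u. *)
Lemma usc_max u K C : dcompact d K -> usc d u -> dopen d (~` C) ->
  K `&` C !=set0 -> exists2 y, (K `&` C) y & forall z, (K `&` C) z -> u z <= u y.
Proof.
move=> Kc uu Co KC0; apply: contrapT => nomax.
have up y : (K `&` C) y -> exists2 z, (K `&` C) z & u y < u z.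
  move=> KCy; apply: contrapT => noz; apply: nomax; exists y => // z KCz.
  by rewrite leNgt; apply/negP => yz; apply: noz; exists z.
have [|z Kz|N [h hh]] :=
  Kc {x | (K `&` C) x} (fun x => [set y | u y < u (sval x)] `|` ~` C).
- move=> x y [/= yx|Cy]; last by have [r r0 hr] := Co _ Cy; exists r => // z /hr; right.
  have [|r r0 hr] := uu y (u (sval x) - u y); first lra.
  by exists r => // z /hr; left => /=; lra.
- have [Cz|Cz] := pselect (C z); last by have [x KCx] := KC0; exists (exist _ x KCx) => //; right.
  by have [x KCx zx] := up z (conj Kz Cz); exists (exist _ x KCx) => //; left.
have [x [Kx Cx]] := KC0; have [i0 _ _] := hh _ Kx.
have [i _ imax] := arg_maxP (P := xpredT) (fun i => u (sval (h i))) (i0 := i0) isT.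
have [Ki Ci] := svalP (h i); have [j _ [/= ij|//]] := hh _ Ki.
by have : u (sval (h j)) <= u (sval (h i)) := imax j isT; rewrite leNgt ij.
Qed.


(** * Level sets and finitely supported fuzzy sets *)

Lemma level0 u : level d u 0 = dclosure d [set x | 0 < u x].
Proof. by rewrite /level eqxx. Qed.

Lemma level_pos u a : 0 < a -> level d u a = [set x | a <= u x].
Proof. by move=> a0; rewrite /level gt_eqF. Qed.

Lemma level0_pos u x : 0 < u x -> level d u 0 x.
Proof. by move=> ux; rewrite level0 => e e0; exists x; rewrite ?dxx. Qed.

Lemma level_sub0 u a : 0 <= a -> level d u a `<=` level d u 0.
Proof.
rewrite le_eqVlt => /predU1P[<-//|a0]; rewrite (level_pos _ a0) => x ax.
by apply: level0_pos; apply: lt_le_trans ax.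
Qed.

(** Points of [y] may coincide, and then the largest weight counts; the map is thus defined on the
    whole power of [X], even where [f] merges points. *)
Definition fin_fuzzy N (w : 'I_N -> R) (y : 'I_N -> X) : X -> R :=
  fun x => \big[Num.max/0]_(i < N | `[< y i = x >]) w i.

Lemma fin_fuzzy_ge0 N (w : 'I_N -> R) y x : 0 <= fin_fuzzy w y x.
Proof. exact: bigmax_ge_id. Qed.

Lemma fin_fuzzy_geP N (w : 'I_N -> R) y x a : 0 < a ->
  a <= fin_fuzzy w y x <-> exists2 i, y i = x & a <= w i.
Proof.
move=> a0; split.
  by move=> /bigmax_geP[|[i /asboolP <- ?]]; [rewrite leNgt a0|exists i].
by move=> [i yx aw]; apply/bigmax_geP; right; exists i => //; apply/asboolP.
Qed.

Lemma fin_fuzzy_leP N (w : 'I_N -> R) y x a : 0 <= a ->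
  fin_fuzzy w y x <= a <-> forall i, y i = x -> w i <= a.
Proof.
move=> a0; split.
  by move=> /bigmax_leP[_ h] i yx; apply/h/asboolP.
by move=> h; apply/bigmax_leP; split=> // i /asboolP; apply: h.
Qed.

Lemma le_fin_fuzzy N (w : 'I_N -> R) y i : w i <= fin_fuzzy w y (y i).
Proof. exact: (fin_fuzzy_leP w y (y i) (fin_fuzzy_ge0 _ _ _)).1 (lexx _) i erefl. Qed.

Lemma fin_fuzzy_gt0 N (w : 'I_N -> R) y x :
  0 < fin_fuzzy w y x -> exists i, y i = x.
Proof. by move=> fx; have [i] := (fin_fuzzy_geP w y x fx).1 (lexx _); exists i. Qed.

(** With positive weights one formula also covers [a = 0]: that level is the closure of the support,
    and a finite support is closed. *)
Lemma level_fin_fuzzy N (w : 'I_N -> R) y a : (forall i, 0 < w i) -> 0 <= a ->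
  level d (fin_fuzzy w y) a = [set x | exists2 i, y i = x & a <= w i].
Proof.
move=> w0; rewrite le_eqVlt => /predU1P[<-|a0]; last first.
  by rewrite level_pos//; apply/seteqP; split=> x /fin_fuzzy_geP; apply.
apply/seteqP; split=> x; last first.
  move=> [i <- _]; apply: level0_pos.
  exact: lt_le_trans (w0 i) (le_fin_fuzzy _ _ _).
have [r r0 hr] := fin_separation y x.
rewrite level0 => /(_ _ r0)[_ /fin_fuzzy_gt0[i <-] /hr <-].
by exists i => //; apply/ltW.
Qed.

Lemma Fspace_fin_fuzzy N (w : 'I_N -> R) y :
  (forall i, 0 < w i <= 1) -> (exists i, w i = 1) -> Fspace d (fin_fuzzy w y).
Proof.
move=> w01 [k wk]; have w0 i : 0 < w i by case/andP: (w01 i).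
split.
- move=> x; rewrite /unit_itv /= fin_fuzzy_ge0; apply/fin_fuzzy_leP => // i _.
  by case/andP: (w01 i).
- move=> x e e0; have [r r0 hr] := fin_separation y x.
  exists r => // z xz; have := fin_fuzzy_ge0 w y x => fx0.
  have := fin_fuzzy_ge0 w y z; rewrite le_eqVlt => /predU1P[<-|]; first lra.
  by move=> /fin_fuzzy_gt0[i iz]; rewrite -iz in xz *; rewrite (hr _ xz); lra.
- have -> : level d (fin_fuzzy w y) 0 = range y.
    rewrite level_fin_fuzzy//; apply/seteqP; split=> x [i] => [<- _|_ <-].
      by exists i.
    by exists i => //; apply/ltW.
  exact: dcompact_fin.
- by exists (y k); rewrite level_fin_fuzzy//; exists k; rewrite ?wk.
Qed.

(** Equal weights select the same indices at every level, so points are matched index by index. *)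
Lemma d_infty_fin_fuzzy N (w : 'I_N -> R) y z s : (forall i, 0 < w i) ->
  (forall i, d (y i) (z i) < s) ->
  (d_infty d (fin_fuzzy w y) (fin_fuzzy w z) <= s%:E)%E.
Proof.
move=> w0 yz; apply: ge_ereal_sup => _ [a /andP[a0 _] <-].
rewrite !level_fin_fuzzy//; apply: hausdorff_le => _ [i <- aw].
  by exists (z i); [exists i|apply/ltW].
by exists (y i); [exists i|rewrite dC; apply/ltW].
Qed.

(* The centres of a finite net of the support of u are replaced by points where
   u is maximal on the closed balls of the net; every level set of u is then
   close to the set of chosen points of at least that level. *)
Lemma fin_fuzzy_dense u r : Fspace d u -> 0 < r ->
  exists N (w : 'I_N -> R) y, [/\ forall i, 0 < w i <= 1, exists i, w i = 1 &
    (d_infty d u (fin_fuzzy w y) < r%:E)%E].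
Proof.
move=> [u01 uu uc [x1]]; rewrite level_pos// => /= ux1 r0.
have e0 : 0 < r / 3 by lra.
have [N [x [xu xnet]]] := dcompact_net uc e0.
pose C i := [set z | d (x i) z <= r / 3].
have Co i : dopen d (~` C i).
  move=> z /= /negP; rewrite -ltNge => xz; exists (d (x i) z - r / 3); first lra.
  by move=> t zt; apply/negP; rewrite -ltNge; have := dD (x i) t z; rewrite (dC t); lra.
have Cx i : (level d u 0 `&` C i) (x i) by split=> //=; rewrite /C /= dxx ltW.
have /choice[y hy] i : exists y, (level d u 0 `&` C i) y /\
    forall z, (level d u 0 `&` C i) z -> u z <= u y.
  have [|y ? ?] := usc_max uc uu (Co i); first by exists (x i).
  by exists y.
(* The centre [x i] lies in the closure of the support, so its ball contains a point of positive
   value, which the maximum dominates. *)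
have w01 i : 0 < u (y i) <= 1.
  have := xu i; rewrite level0 => /(_ _ e0)[z /= uz xz].
  have /andP[_ ->] := u01 (y i); rewrite andbT; apply: (lt_le_trans uz).
  by apply: (hy i).2; split; [exact: level0_pos|exact: ltW].
have net z : level d u 0 z -> exists i, d (x i) z <= r / 3 /\ u z <= u (y i).
  move=> uz; have [i xz] := xnet _ uz; exists i; split; first exact: ltW.
  by apply: (hy i).2; split=> //; exact: ltW.
exists N, (u \o y), y; split=> //.
  have [|i [_ xy]] := net x1; first by apply: level0_pos; lra.
  exists i => /=; apply/eqP; rewrite eq_le (le_trans ux1 xy).
  by case/andP: (w01 i) => _ ->.
apply: (@le_lt_trans _ _ (2 * r / 3)%:E); last by rewrite lte_fin; lra.
apply: ge_ereal_sup => _ [a /andP[a0 _] <-].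
rewrite level_fin_fuzzy//; last by move=> i; case/andP: (w01 i).
apply: hausdorff_le.
- move=> z az; have [i [xz zy]] := net _ (level_sub0 a0 az).
  exists (y i); last first.
    have xy : d (x i) (y i) <= r / 3 := (hy i).1.2.
    by have := dD z (x i) (y i); rewrite (dC z (x i)); lra.
  exists i => //=; move: a0; rewrite le_eqVlt => /predU1P[<-|a0].
    by case/andP: (w01 i) => /ltW.
  by apply: le_trans zy; move: az; rewrite level_pos.
- move=> _ [i <- ayi]; exists (y i); last by rewrite dxx; lra.
  move: a0; rewrite le_eqVlt => /predU1P[<-|a0]; first exact: (hy i).1.1.
  by rewrite level_pos.
Qed.

(** * Zadeh's extension *)

Lemma zadeh_unit_itv (f : X -> X) (u : X -> R) : (forall x, unit_itv (u x)) ->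
  forall x, unit_itv (zadeh f u x).
Proof.
move=> u01 x; rewrite /zadeh; case: pselect => [[y fy]|nfy] /=; last first.
  by rewrite /unit_itv /= lexx ler01.
have ub : ubound [set u z | z in f @^-1` [set x]] 1.
  by move=> _ [z _ <-]; case/andP: (u01 z).
apply/andP; split; last by apply: ge_sup => //; exists (u y), y.
have /andP[uy _] := u01 y; apply: le_trans uy _.
by apply: ub_le_sup; [exists 1|exists y].
Qed.

Lemma zadeh_ge (f : X -> X) (u : X -> R) y : (forall x, unit_itv (u x)) -> u y <= zadeh f u (f y).
Proof.
move=> u01; rewrite /zadeh; case: pselect => [fy|[]] /=; last by exists y.
by apply: ub_le_sup; [exists 1 => _ [z _ <-]; case/andP: (u01 z)|exists y].
Qed.

(** This is the equivariance of [fin_fuzzy w]: points merged by [f] receive the largest of their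
    weights, in agreement with Zadeh's supremum. *)
Lemma zadeh_fin_fuzzy (f : X -> X) N (w : 'I_N -> R) y :
  (forall i, w i <= 1) ->
  fin_fuzzy w (Defs.fprod f y) = zadeh f (fin_fuzzy w y).
Proof.
move=> w1.
have u01 x : unit_itv (fin_fuzzy w y x).
  by rewrite /unit_itv /= fin_fuzzy_ge0; apply/fin_fuzzy_leP.
apply/funext => x; apply/eqP; rewrite eq_le; apply/andP; split.
  apply/fin_fuzzy_leP => [|i <-]; first by case/andP: (zadeh_unit_itv f u01 x).
  apply: le_trans (zadeh_ge _ _ u01).
  exact: le_fin_fuzzy.
rewrite /zadeh; case: pselect => [[z fz]|nfx] /=; last exact: fin_fuzzy_ge0.
apply: ge_sup; first by exists (fin_fuzzy w y z), z.
move=> _ [t ft <-]; apply/fin_fuzzy_leP => [|i yt]; first exact: fin_fuzzy_ge0.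
by rewrite -ft -yt; exact: (le_fin_fuzzy w (Defs.fprod f y)).
Qed.

(** * From the powers of [X] to compact and fuzzy sets *)

Lemma hausdorff_range N (y z : 'I_N -> X) s : (forall i, d (y i) (z i) < s) ->
  (hausdorff d (range y) (range z) <= s%:E)%E.
Proof.
move=> yz; apply: hausdorff_le => _ [i _ <-].
  by exists (z i); [exists i|apply/ltW].
by exists (y i); [exists i|rewrite dC; apply/ltW].
Qed.

Lemma hausdorff_net N (y : 'I_N -> X) K s : (forall i, K (y i)) ->
  (forall z, K z -> exists i, d (y i) z < s) ->
  0 <= s -> (hausdorff d K (range y) <= s%:E)%E.
Proof.
move=> Ky net s0; apply: hausdorff_le => [z /net[i yz]|_ [i _ <-]].
  by exists (y i); [exists i|rewrite dC ltW].
by exists (y i); rewrite ?dxx.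
Qed.

Lemma lA_recurrent_Kspace (f : X -> X) l A : up_closed A ->
  (forall N, (0 < N)%N ->
    lA_recurrent l A setT (Defs.prod_ball d (N:=N)) (Defs.fprod f (N:=N))) ->
  lA_recurrent l A (Kspace d) (Kball d) (Kmap f).
Proof.
move=> Aup; apply: lA_recurrent_dense => // K r [[z Kz] Kc] r0.
have r2 : 0 < r / 2 by lra.
have [N [x [Kx net]]] := dcompact_net Kc r2.
have [i0 _] := net z Kz.
exists N; split; first exact: leq_ltn_trans (leq0n i0) (ltn_ord i0).
exists (fun y => range y); split.
- by move=> y; split; [exists (y i0), i0|exact: dcompact_fin].
- by move=> y; rewrite /Kmap image_comp.
- by move=> y t s _; exact: hausdorff_range.
- exists x; apply: le_lt_trans (hausdorff_net Kx net (ltW r2)) _.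
  by rewrite lte_fin; lra.
Qed.

Lemma lA_recurrent_Fspace (f : X -> X) l A : up_closed A ->
  (forall N, (0 < N)%N ->
    lA_recurrent l A setT (Defs.prod_ball d (N:=N)) (Defs.fprod f (N:=N))) ->
  lA_recurrent l A (Fspace d) (rho_ball (d_infty d)) (zadeh f).
Proof.
move=> Aup; apply: lA_recurrent_dense => // u r Fu r0.
have [N [w [y [w01 [i0 wi0] uy]]]] := fin_fuzzy_dense Fu r0.
exists N; split; first exact: leq_ltn_trans (leq0n i0) (ltn_ord i0).
exists (fin_fuzzy w); split.
- by move=> z; apply: Fspace_fin_fuzzy => //; exists i0.
- by move=> z; apply: zadeh_fin_fuzzy => i; case/andP: (w01 i).
- by move=> z t s _; apply: d_infty_fin_fuzzy => i; case/andP: (w01 i).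
- by exists y.
Qed.

(** * Comparison of the four metrics *)

Lemma d_skor_le_infty u v r : Fspace d v ->
  (d_infty d u v < r%:E)%E -> (d_skor d u v <= r%:E)%E.
Proof.
(* The infimum defining [d_skor] ranges over positive numbers; positivity of [r] comes from a pair
   of points on the top levels. *)
move=> [v01 _ _ [x vx]] uv; have r0 : 0 < r.
  have h : (hausdorff d (level d u 1) (level d v 1) < r%:E)%E.
    apply: le_lt_trans uv; apply: ereal_sup_ubound; exists 1 => //.
    by rewrite /unit_itv /= ler01 lexx.
  by have [y _ xy] := (hausdorff_lt h).2 x vx; have := d_ge0 x y; lra.
apply: ereal_inf_lbound; exists r => //; split => //; exists id; split.
- split=> //; first by move=> b; exists b.
  by move=> a e _ e0; exists e.
- by move=> a _; rewrite subrr normr0 ltW.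
- exact: ltW.
Qed.

(** If 0 were attained at some [a > 0], monotonicity would push [xi 0] below 0. Consequently
    reparametrisation preserves the support. *)
Lemma homeoI0 (xi : R -> R) : homeoI xi -> xi 0 = 0.
Proof.
move=> [xi01 xisurj xiincr _].
have I0 : unit_itv (0 : R) by rewrite /unit_itv /= lexx ler01.
have [a /[dup] /andP[+ _] Ia xa] := xisurj 0 I0.
rewrite le_eqVlt => /predU1P[a0|a0]; first by rewrite {1}a0.
have := xiincr _ _ I0 Ia a0; have /andP[] := xi01 _ I0; lra.
Qed.

(** For [a > 0], the level of [xi \o v] at [a = xi b] is the level of [v] at [b]. So height [a] over
    [u] is matched with height [b] over [v], at vertical cost at most [e]; at height 0 the supports
    are matched directly. *)
Lemma d_S_le_skor u v r : Fspace d u -> Fspace d v ->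
  (d_skor d u v < r%:E)%E -> (d_S d u v <= r%:E)%E.
Proof.
move=> [u01 _ _ _] [v01 _ _ _] /ereal_inf_lt[_ [e [e0 [xi [hxi xie uxv]]] <-]].
rewrite lte_fin => er; have xi0 := homeoI0 hxi.
have [xi01 xisurj xiincr _] := hxi.
have I0 : unit_itv (0 : R) by rewrite /unit_itv /= lexx ler01.
have lev a : unit_itv a -> (hausdorff d (level d u a) (level d (xi \o v) a) < r%:E)%E.
  move=> Ia; apply: (@le_lt_trans _ _ e%:E); last by rewrite lte_fin.
  by apply: le_trans uxv; apply: ereal_sup_ubound; exists a.
have xigt0 a : unit_itv a -> 0 < xi a -> 0 < a.
  move=> /andP[]; rewrite le_eqVlt => /predU1P[<-|//].
  by rewrite xi0 ltxx.
have xv0 : level d (xi \o v) 0 = level d v 0.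
  rewrite !level0; congr (dclosure d _); apply/seteqP; split=> x /=.
    exact: xigt0.
  by move=> vx; rewrite -xi0; apply: xiincr.
apply: hausdorff_le.
- move=> [x a] [[/= Ia ax] ux].
  have [a0|a0] := eqVneq a 0.
    have [y] := (hausdorff_lt (lev _ I0)).1 _ ux.
    rewrite xv0 => vy xy; exists (y, 0).
      by split=> //; split=> //=; case/andP: (v01 y).
    by rewrite /dbar /= a0 subrr normr0 ge_max !ltW// (lt_trans e0).
  have {}a0 : 0 < a by rewrite lt_neqAle eq_sym a0; case/andP: Ia.
  have [|y] := (hausdorff_lt (lev _ Ia)).1 x; first by rewrite level_pos.
  rewrite level_pos//= => ay xy; have [b Ib xb] := xisurj _ Ia.
  exists (y, b).
    split; last by apply: level0_pos; apply: xigt0 => //; exact: lt_le_trans ay.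
    split=> //=; rewrite leNgt; apply/negP => /(xiincr _ _ (v01 y) Ib).
    by rewrite xb; lra.
  by rewrite /dbar /= -{1}xb ge_max ltW//= (le_trans (xie _ Ib))// ltW.
- move=> [y b] [[/= Ib by_] vy].
  have [b0|b0] := eqVneq b 0.
    have [|x ux yx] := (hausdorff_lt (lev _ I0)).2 y; first by rewrite xv0.
    exists (x, 0); last first.
      by rewrite /dbar /= b0 subrr normr0 ge_max !ltW// (lt_trans e0).
    by split=> //; split=> //=; case/andP: (u01 x).
  have {}b0 : 0 < b by rewrite lt_neqAle eq_sym b0; case/andP: Ib.
  have xb : 0 < xi b by rewrite -xi0; apply: xiincr.
  have [|x] := (hausdorff_lt (lev _ (xi01 _ Ib))).2 y.
    rewrite level_pos//=; move: by_; rewrite le_eqVlt => /predU1P[->//|].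
    by move=> /(xiincr _ _ Ib (v01 y))/ltW.
  rewrite level_pos//= => bx yx; exists (x, xi b).
    split; last by apply: level0_pos; apply: lt_le_trans bx.
    by split=> //=; apply: xi01.
  by rewrite /dbar /= distrC ge_max ltW//= (le_trans (xie _ Ib))// ltW.
Qed.

(** An endograph adds to the sendograph only points of height 0, which all endographs share; these
    are matched with themselves. *)
Lemma d_E_le_S u v r : Fspace d u -> Fspace d v ->
  (d_S d u v < r%:E)%E -> (d_E d u v <= r%:E)%E.
Proof.
move=> [u01 _ _ [x1]]; rewrite level_pos// => ux1 [v01 _ _ _] uv.
have [hu hv] := hausdorff_lt uv.
have r0 : 0 < r.
  have [|q _ qr] := hu (x1, 1); last first.
    by apply: le_lt_trans qr; rewrite /dbar le_max d_ge0.
  split; first by split=> //; rewrite /unit_itv /= ler01 lexx.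
  by apply: level0_pos; apply: lt_le_trans ux1.
have half (u1 u2 : X -> R) : (forall x, unit_itv (u2 x)) ->
    (forall p, sendo d u1 p -> exists2 q, sendo d u2 q & dbar d p q < r) ->
    forall p, endo u1 p -> exists2 q, endo u2 q & dbar d p q <= r.
  move=> u201 h [x a] [/= Ia ax].
  have [a0|a0] := eqVneq a 0.
    exists (x, 0); last by rewrite /dbar /= dxx a0 subrr normr0 maxxx ltW.
    by split; [rewrite /unit_itv /= lexx ler01|case/andP: (u201 x)].
  have {}a0 : 0 < a by rewrite lt_neqAle eq_sym a0; case/andP: Ia.
  have [|q [qe _] qr] := h (x, a); last by exists q; rewrite ?ltW.
  by split=> //; apply: level0_pos; apply: lt_le_trans ax.
by apply: hausdorff_le; exact: half.
Qed.


(** * From collective returns to pointwise returns *)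

Lemma dopen_iter (f : X -> X) m U : dcontinuous d f -> dopen d U ->
  dopen d [set z | U (iter m f z)].
Proof.
move=> fc; elim: m U => // m IH U Uo; apply: (IH [set z | U (f z)]).
move=> z /Uo[r r0 hr]; have [s s0 hs] := fc z r r0.
by exists s => // t /hs/hr.
Qed.

Lemma dopenI U V : dopen d U -> dopen d V -> dopen d (U `&` V).
Proof.
move=> Uo Vo z [/Uo[r r0 hr] /Vo[s s0 hs]].
exists (Num.min r s) => [|t]; first by rewrite lt_min r0.
by rewrite lt_min => /andP[/hr ? /hs].
Qed.

Lemma iter_fprod (f : X -> X) N (y : 'I_N -> X) m :
  iter m (@Defs.fprod _ f N) y = fun i => iter m f (y i).
Proof. by elim: m => //= m ->. Qed.

Section Trace.
Context {f : X -> X} (fc : dcontinuous d f).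
Context {Y : Type} {P : set Y} {ball : Y -> R -> set Y} {g : Y -> Y}.
(* Tr y is the set of points of X followed in the collective state y: K itself
   for a compact set K, the 1/2-level set for a fuzzy set. *)
Variable Tr : Y -> set X.
Hypothesis Tr_map : forall y z, Tr y z -> Tr (g y) (f z).
(** Every ball contains a traced point and every traced point lies in some ball, but nothing says
    which ball a moving point reaches. *)
Hypothesis Tr_dense : forall N (x : 'I_N.+1 -> X) r, 0 < r ->
  exists W, [/\ sp_open P ball W, W !=set0,
    forall y i, W y -> exists2 z, Tr y z & d (x i) z < r &
    forall y z, W y -> Tr y z -> exists i, d (x i) z < r].

Lemma Tr_iter m y z : Tr y z -> Tr (iter m g y) (iter m f z).
Proof. by move=> yz; elim: m => //= m; apply: Tr_map. Qed.

(** A point traced near [x i] is, at each time [j * n], in some ball; the absence of arrows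
    identifies that ball as the one of index [i]. The case [m = 0] of the hypothesis makes the sets
    disjoint. *)
Lemma no_arrow_return l N (U : 'I_N.+1 -> set X) :
  (forall i, dopen d (U i)) -> (forall i, U i !=set0) ->
  (forall i k m z, U i z -> U k (iter m f z) -> i = k) ->
  exists W, [/\ sp_open P ball W, W !=set0 &
    forall i, Nl g l W `<=` Nl f l (U i)].
Proof.
move=> Uo /choice[x Ux] noarrow.
have [i r s _ sr h y xy|i|r r0 hr] :=
    @fin_radius R N.+1 (fun i r => forall y, d (x i) y < r -> U i y).
- by apply: h; apply: lt_le_trans sr.
- exact: Uo.
have [W [Wo W0 near_x cover]] := Tr_dense x r0.
exists W; split=> // i n [y [Wy hy]].
have [z yz /hr Uz] := near_x _ i Wy; exists z; split=> // j /hy Wj.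
have [k /hr Ukz] := cover _ _ Wj (Tr_iter (j * n) yz).
by rewrite (noarrow _ _ _ _ Uz Ukz).
Qed.

(** Induction on the number of sets. Given an arrow from [U i] to [U k] at time [m], drop [U k] and
    shrink [U i] to the points sent into [U k]; since iterates of [f] commute, returns to the
    shrunken set are carried by [iter m f] to returns to [U k]. *)
Lemma open_family_return l N (U : 'I_N.+1 -> set X) :
  (forall i, dopen d (U i)) -> (forall i, U i !=set0) ->
  exists W, [/\ sp_open P ball W, W !=set0 &
    forall i, Nl g l W `<=` Nl f l (U i)].
Proof.
elim: N U => [|N IH] U Uo U0.
  by apply: no_arrow_return => // i k *; rewrite !ord1.
have [[i [k [m [ik [z [Uz Ufz]]]]]]|noarrow] :=
  pselect (exists i k m, i != k /\ exists z, U i z /\ U k (iter m f z)); last first.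
  apply: no_arrow_return => // i k m z Uz Ukz; apply/eqP; apply: contrapT => /negP ik.
  by apply: noarrow; exists i, k, m; split=> //; exists z.
(* [lift k] enumerates the indices other than [k]; the implication constrains only the index [i]. *)
pose V j := U (lift k j) `&` [set z | lift k j = i -> U k (iter m f z)].
have [j|j|W [Wo W0 hW]] := IH V.
- apply: dopenI => //; have [ji|ji] := eqVneq (lift k j) i.
    move=> x /(_ ji)/(dopen_iter fc (Uo k))[r r0 hr].
    by exists r => // y /hr Ufy _.
  by move=> x _; exists 1 => // y _ /eqP; rewrite (negPf ji).
- have [ji|/eqP ji] := eqVneq (lift k j) i; last first.
    by have [x Ux] := U0 (lift k j); exists x; split.
  by exists z; split=> [|_]; rewrite ?ji.
exists W; split=> // t n Wn; have [j ->|->] := unliftP k t.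
  by apply: (Nl_sub (phi := id)) (hW j n Wn) => // x [].
rewrite eq_sym in ik; have [j ij _] := unlift_some ik.
apply: (Nl_sub (phi := iter m f)) (hW j n Wn) => [q y|y [_ Vy]].
  by rewrite -!iterD addnC.
exact: Vy.
Qed.

(** One [W] serves all coordinates, so they return at a common [n], and the coordinatewise witnesses
    form a point of the power. *)
Lemma lA_recurrent_fprod l A : up_closed A -> lA_recurrent l A P ball g ->
  forall N, (0 < N)%N ->
    lA_recurrent l A setT (Defs.prod_ball d (N:=N)) (Defs.fprod f (N:=N)).
Proof.
move=> Aup rec [//|N] _ V [_ Vo] [x Vx]; have [r r0 hr] := Vo _ Vx.
have [||W [Wo W0 hW]] := @open_family_return l N (fun i => [set z | d (x i) z < r]).
- by move=> i; apply: dopen_ball.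
- by move=> i; exists (x i); rewrite /= dxx.
apply: Aup (rec _ Wo W0) _ => n Wn.
have /choice[z hz] i := hW i n Wn.
exists z; split; first by apply: hr => // i; case: (hz i).
by move=> j jl; rewrite iter_fprod; apply: hr => // i; apply: (hz i).2.
Qed.

End Trace.

(** * Back from compact and fuzzy sets to the powers *)

Lemma lA_recurrent_fprod_Kspace (f : X -> X) l A : dcontinuous d f -> up_closed A ->
  lA_recurrent l A (Kspace d) (Kball d) (Kmap f) ->
  forall N, (0 < N)%N ->
    lA_recurrent l A setT (Defs.prod_ball d (N:=N)) (Defs.fprod f (N:=N)).
Proof.
move=> fc Aup; apply: (lA_recurrent_fprod fc (Tr := id)) => //.
  by move=> K z Kz; exists z.
move=> N x r r0.
exists [set K | Kspace d K /\ (hausdorff d (range x) K < r%:E)%E]; split.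
- apply: sp_open_rho_ball => K L s t; exact: hausdorff_triangle.
- exists (range x); split; first by split; [exists (x ord0), ord0|exact: dcompact_fin].
  apply: (@le_lt_trans _ _ (r / 2)%:E); last by rewrite lte_fin; lra.
  by apply: hausdorff_range => i; rewrite dxx; lra.
- by move=> K i [_ /hausdorff_lt[h _]]; apply: h; exists i.
- move=> K z [_ /hausdorff_lt[_ h]] /h[_ [i _ <-]].
  by rewrite dC; exists i.
Qed.

Lemma dbar_triangle p q s : dbar d p s <= dbar d p q + dbar d q s.
Proof.
rewrite /dbar ge_max; apply/andP; split.
  by apply: le_trans (dD _ q.1 _) _; apply: lerD; rewrite le_max lexx.
by apply: le_trans (ler_distD q.2 _ _) _; apply: lerD; rewrite le_max lexx orbT.
Qed.

Lemma hausdorff_xx T (D : T -> T -> R) B : (forall x, D x x = 0) ->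
  (hausdorff D B B <= 0%:E)%E.
Proof. by move=> D0; apply: hausdorff_le => x Bx; exists x; rewrite ?D0. Qed.

Lemma lA_recurrent_fprod_Fspace (f : X -> X) l A : dcontinuous d f -> up_closed A ->
  lA_recurrent l A (Fspace d) (rho_ball (d_E d)) (zadeh f) ->
  forall N, (0 < N)%N ->
    lA_recurrent l A setT (Defs.prod_ball d (N:=N)) (Defs.fprod f (N:=N)).
Proof.
(* The bound on the values is part of [Tr], because [Tr_map] concerns arbitrary functions and the
   supremum in [zadeh] must be bounded. *)
move=> fc Aup; pose Tr (v : X -> R) : set X :=
  [set z | (forall x, unit_itv (v x)) /\ 1 / 2 <= v z].
apply: (lA_recurrent_fprod fc (Tr := Tr)) => //.
  move=> v z [v01 vz]; split; first exact: zadeh_unit_itv.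
  exact: le_trans vz (zadeh_ge _ _ v01).
(* With [s <= 1 / 2], height 1 over [u] is matched above 1/2 over [v], and height 1/2 over [v] is
   matched above 0 over [u], hence over some [x i]. *)
move=> N x r r0; pose s := Num.min r (1 / 2).
have s0 : 0 < s by rewrite lt_min r0; lra.
have s2 : s <= 1 / 2 by rewrite ge_min lexx orbT.
have sr : s <= r by rewrite ge_min lexx.
pose u := fin_fuzzy (fun=> 1) x.
have u1 i : u (x i) = 1.
  apply/eqP; rewrite eq_le (le_fin_fuzzy (fun=> 1) x) andbT.
  by apply/fin_fuzzy_leP.
exists [set v | Fspace d v /\ (d_E d u v < s%:E)%E]; split.
- apply: sp_open_rho_ball => K L s1 t; apply: hausdorff_triangle.
  exact: dbar_triangle.
- exists u; split.
    by apply: Fspace_fin_fuzzy => [i|]; [rewrite ltr01 lexx|exists ord0].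
  apply: (@le_lt_trans _ _ 0%:E); last by rewrite lte_fin.
  by apply: hausdorff_xx => p; rewrite /dbar dxx subrr normr0 maxxx.
- move=> v i [[v01 _ _ _] /hausdorff_lt[h _]].
  have [|[z b] [_ /= bz]] := h (x i, 1).
    by split; rewrite /= ?u1// /unit_itv /= ler01 lexx.
  rewrite /dbar /= gt_max ltr_distl => /andP[xz /andP[b1 b2]].
  by exists z; [split=> //; lra|lra].
- move=> v z [_ /hausdorff_lt[_ h]] [v01 vz].
  have [|[t b] [_ /= bt]] := h (z, 1 / 2).
    by split=> //=; rewrite /unit_itv /=; lra.
  rewrite /dbar /= gt_max ltr_distl => /andP[xz /andP[b1 b2]].
  have [|i it] := @fin_fuzzy_gt0 N.+1 (fun=> 1) x t; first by rewrite -/u; lra.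
  by exists i; rewrite it dC; lra.
Qed.

(** * The cycle of implications and the four notions of recurrence *)

Lemma six_equiv_lA (f : X -> X) (L : set nat) A (Q : space_prop R) :
  dcontinuous d f -> up_closed A ->
  (forall (Y : Type) (P : set Y) ball g,
     Q Y P ball g <-> forall l, L l -> lA_recurrent l A P ball g) ->
  six_equiv d f Q.
Proof.
move=> fc Aup QE; rewrite /six_equiv.
have QfromN Y P ball g : (forall l, L l ->
    (forall N, (0 < N)%N ->
       lA_recurrent l A setT (Defs.prod_ball d (N:=N)) (Defs.fprod f (N:=N))) ->
    lA_recurrent l A P ball g) ->
  (forall N, (0 < N)%N -> Q _ setT (Defs.prod_ball d (N:=N)) (Defs.fprod f (N:=N))) ->
  Q Y P ball g.
  by move=> h HQ; apply/QE => l Ll; apply: (h l Ll) => N N0; exact: ((QE _ _ _ _).1 (HQ N N0) l Ll).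
tfae.
- apply: QfromN => l _; exact: lA_recurrent_Kspace.
(* Compact sets lead to fuzzy sets by way of the powers of [X]. *)
- move=> HK; apply: QfromN => [l _|N N0]; first exact: lA_recurrent_Fspace.
  apply/QE => l Ll; apply: lA_recurrent_fprod_Kspace => //.
  exact: (QE _ _ _ _).1 HK _ Ll.
- move=> /QE H; apply/QE => l Ll; apply: lA_recurrent_coarser (H l Ll).
  by move=> u v r _ Fv; exact: d_skor_le_infty.
- move=> /QE H; apply/QE => l Ll; apply: lA_recurrent_coarser (H l Ll).
  by move=> u v r; exact: d_S_le_skor.
- move=> /QE H; apply/QE => l Ll; apply: lA_recurrent_coarser (H l Ll).
  by move=> u v r; exact: d_E_le_S.
- move=> /QE H N N0; apply/QE => l Ll; apply: lA_recurrent_fprod_Fspace => //.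
  exact: H.
Qed.

End Metric.

Theorem theorem3p3 (R : realType) (X : Type) (d : X -> X -> R) (f : X -> X)
  (l : nat) (A : set (set nat)) :
  is_metric d -> dcontinuous d f -> (0 < l)%N -> furstenberg A ->
  [/\ six_equiv d f (lA_recurrent l A),
      six_equiv d f (@top_recurrent R),
      six_equiv d f (@mult_recurrent R) &
      six_equiv d f (@A_recurrent R A)].
Proof.
move=> dm fc _ [_ Aup].
(* Membership in [Apos] expresses a return at some positive time: topological recurrence is the case
   [l = 1], multiple recurrence the conjunction over all [l > 0]. *)
pose Apos : set (set nat) := [set S | exists n, (0 < n)%N /\ S n].
have Apos_up : up_closed Apos by move=> S S' [n [n0 Sn]] SS'; exists n; split => //; exact: SS'.
have Nl1 Y (g : Y -> Y) U : Nl g 1 U = [set n | exists y, U y /\ U (iter n g y)].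
  apply/seteqP; split=> n [y [Uy h]]; exists y; split=> //.
    by have := h 1%N isT; rewrite mul1n.
  by case=> [|[|//]] _; rewrite ?mul0n ?mul1n.
split.
- apply: (@six_equiv_lA _ _ _ dm f [set l] A) => // Y P ball g.
  by split=> [H _ ->//|]; apply.
- apply: (@six_equiv_lA _ _ _ dm f [set 1%N] Apos) => // Y P ball g.
  split=> [H _ -> U Uo U0|H U Uo U0]; first by rewrite Nl1; exact: H.
  by have := H _ erefl U Uo U0; rewrite Nl1.
- apply: (@six_equiv_lA _ _ _ dm f [set l | (0 < l)%N] Apos) => // Y P ball g.
- apply: (@six_equiv_lA _ _ _ dm f [set 1%N] A) => // Y P ball g.
  split=> [H _ -> U Uo U0|H U Uo U0]; first by rewrite Nl1; exact: H.
  by have := H _ erefl U Uo U0; rewrite Nl1.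
Qed.
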